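(* Let $A(s),C(s)$ be fixed $n\times n$ real polynomial matrices, let $\mathcal{B}(s),\mathcal{D}(s)$ be $n\times n$ interval polynomial matrices, and let $\mathcal{M}(s)=\mathcal{B}(s)A(s)+\mathcal{D}(s)C(s)=\{B(s)A(s)+D(s)C(s): B(s)\in\mathcal{B}(s),\,D(s)\in\mathcal{D}(s)\}$. Suppose that the leading coefficient matrix is nonsingular over the whole family, i.e. there is an integer $N\ge 0$ such that every member of $\mathcal{M}(s)$ has the form $M_Ns^N+M_{N-1}s^{N-1}+\cdots+M_0$ with $n\times n$ scalar matrices $M_k$ and $\det(M_N)\neq 0$. Then $B(s)A(s)+D(s)C(s)$ is stable for all $B(s)\in\mathcal{B}(s)$ and $D(s)\in\mathcal{D}(s)$ if and only if $B(s)A(s)+D(s)C(s)$ is stable for all pairs $(B(s),D(s))\in\mathcal{BD}$, where $\mathcal{BD}\subset\mathcal{B}(s)\times\mathcal{D}(s)$ is the testing set defined in the context.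
   Context: Interval polynomial matrices. Let $n\ge1$ and $m\ge 0$ be integers. For $1\le i,j\le n$ and $0\le k\le m$ let real numbers $\underline{b}_{ij}^{(k)}\le\overline{b}_{ij}^{(k)}$ and $\underline{d}_{ij}^{(k)}\le\overline{d}_{ij}^{(k)}$ be given. Put $$\mathcal{B}_{ij}(s)=\Big\{\sum_{k=0}^m b_{ij}^{(k)}s^k:\ b_{ij}^{(k)}\in[\underline{b}_{ij}^{(k)},\overline{b}_{ij}^{(k)}]\Big\},\qquad \mathcal{D}_{ij}(s)=\Big\{\sum_{k=0}^m d_{ij}^{(k)}s^k:\ d_{ij}^{(k)}\in[\underline{d}_{ij}^{(k)},\overline{d}_{ij}^{(k)}]\Big\},$$ where the coefficients vary independently, and $$\mathcal{B}(s)=\{(b_{ij}(s))_{n\times n}: b_{ij}(s)\in\mathcal{B}_{ij}(s)\},\qquad \mathcal{D}(s)=\{(d_{ij}(s))_{n\times n}: d_{ij}(s)\in\mathcal{D}_{ij}(s)\}.$$ Stability. A fixed polynomial is (Hurwitz) stable if all its roots lie in the open left half of the complex plane. A square polynomial matrix is stable if its determinant is stable. Kharitonov vertex and edge sets. For an interval polynomial set $\mathcal{R}(s)=\{\sum_{i=0}^m r_is^i: r_i\in[r_i^L,r_i^U]\}$ define $$r_1(s)=r_0^L+r_1^Ls+r_2^Us^2+r_3^Us^3+r_4^Ls^4+\cdots,$$ $$r_2(s)=r_0^L+r_1^Us+r_2^Us^2+r_3^Ls^3+r_4^Ls^4+\cdots,$$ $$r_3(s)=r_0^U+r_1^Ls+r_2^Ls^2+r_3^Us^3+r_4^Us^4+\cdots,$$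 $$r_4(s)=r_0^U+r_1^Us+r_2^Ls^2+r_3^Ls^3+r_4^Us^4+\cdots$$ (the pattern of $L$ and $U$ is periodic in the degree with period 4, and the sums stop at degree $m$). The Kharitonov vertex set is $\mathcal{R}^V(s)=\{r_1(s),r_2(s),r_3(s),r_4(s)\}$ and the Kharitonov edge set is $\mathcal{R}^E(s)=\{\lambda r_i(s)+(1-\lambda)r_j(s): (i,j)\in\{(1,2),(2,4),(4,3),(3,1)\},\ \lambda\in[0,1]\}$. The sets $\mathcal{B}^V_{ij}(s),\mathcal{B}^E_{ij}(s),\mathcal{D}^V_{ij}(s),\mathcal{D}^E_{ij}(s)$ are those of $\mathcal{B}_{ij}(s)$ and $\mathcal{D}_{ij}(s)$. Testing set. Let $S_n$ be the set of all bijections of $\{1,\dots,n\}$ onto itself and $T_n$ the set of all functions from $\{1,\dots,n\}$ to itself. Let $\mathcal{B}_E(s)$ be the set of $B(s)=(b_{ij}(s))\in\mathcal{B}(s)$ for which there is $\sigma\in S_n$ such that $b_{ij}(s)\in\mathcal{B}^E_{ij}(s)$ whenever $j=\sigma(i)$ and $b_{ij}(s)\in\mathcal{B}^V_{ij}(s)$ whenever $j\ne\sigma(i)$. Let $\mathcal{D}_E(s)$ be the set of $D(s)=(d_{ij}(s))\in\mathcal{D}(s)$ for which there is $\sigma\in S_n$ such that $d_{ij}(s)\in\mathcal{D}^E_{ij}(s)$ whenever $j=\sigma(i)$ and $d_{ij}(s)\in\mathcal{D}^V_{ij}(s)$ whenever $j\neq\sigma(i)$ (the bijections for $B$ and for $D$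 may differ). Let $\mathcal{BD}$ be the set of all pairs $(B(s),D(s))\in\mathcal{B}_E(s)\times\mathcal{D}_E(s)$ for which there is $\eta\in T_n$ such that for all $i,j$: $$(b_{ij}(s),d_{ij}(s))\in\big(\mathcal{B}^E_{ij}(s)\times\mathcal{D}^V_{ij}(s)\big)\cup\big(\mathcal{B}^V_{ij}(s)\times\mathcal{D}^E_{ij}(s)\big)\quad\text{if } j=\eta(i),$$ $$(b_{ij}(s),d_{ij}(s))\in\mathcal{B}^V_{ij}(s)\times\mathcal{D}^V_{ij}(s)\quad\text{if } j\ne\eta(i).$$ *)

(* Defs.v *)
From HB Require Import structures.
From mathcomp Require Import all_boot all_order all_algebra all_fingroup.
From mathcomp Require Import all_classical all_reals.
From mathcomp Require Import complex.

Set Implicit Arguments.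
Unset Strict Implicit.
Unset Printing Implicit Defensive.

Import Order.TTheory GRing.Theory Num.Theory.

Local Open Scope classical_set_scope.
Local Open Scope ring_scope.
Local Open Scope complex_scope.

(* The zero polynomial has every complex number as a root, so it is not
   stable; a nonzero constant is vacuously stable. *)
Definition stable_poly (R : realType) (p : {poly R}) : Prop :=
  forall z : R[i], root (map_poly (real_complex R) p) z -> complex.Re z < 0.

Definition stable_mx (R : realType) (n : nat) (P : 'M[{poly R}]_n) : Prop :=
  stable_poly (\det P).

Section IntervalPoly.
Variables (R : realType) (m : nat).

Definition poly_of_coefs (r : 'I_m.+1 -> R) : {poly R} :=
  \sum_(k < m.+1) r k *: 'X^k.

Variables L U : 'I_m.+1 -> R.

Definition interval_poly : set {poly R} :=
  [set p | exists2 r : 'I_m.+1 -> R,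
     (forall k, L k <= r k <= U k) & p = poly_of_coefs r].

(* [upper] lists the residues mod 4 of the degrees at which the upper bound is
   taken; the lower bound is taken at all other degrees. *)
Definition kharitonov (upper : seq nat) : {poly R} :=
  poly_of_coefs (fun k => if (k %% 4)%N \in upper then U k else L k).

Definition kharitonov1 := kharitonov [:: 2; 3]%N.
Definition kharitonov2 := kharitonov [:: 1; 2]%N.
Definition kharitonov3 := kharitonov [:: 0; 3]%N.
Definition kharitonov4 := kharitonov [:: 0; 1]%N.

Definition vertex_set : set {poly R} :=
  [set kharitonov1; kharitonov2; kharitonov3; kharitonov4].

Definition poly_segment (p q : {poly R}) : set {poly R} :=
  [set r | exists2 t : R, 0 <= t <= 1 & r = t *: p + (1 - t) *: q].

Definition edge_set : set {poly R} :=
  poly_segment kharitonov1 kharitonov2 `|`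
  poly_segment kharitonov2 kharitonov4 `|`
  poly_segment kharitonov4 kharitonov3 `|`
  poly_segment kharitonov3 kharitonov1.

End IntervalPoly.

Section IntervalMatrix.
Variables (R : realType) (m n : nat).
Implicit Types L U : 'I_n -> 'I_n -> 'I_m.+1 -> R.

Definition interval_mx L U : set 'M[{poly R}]_n :=
  [set P | forall i j, interval_poly (L i j) (U i j) (P i j)].

Definition edge_mx L U : set 'M[{poly R}]_n :=
  [set P | interval_mx L U P /\
     exists sigma : 'S_n, forall i j,
       (j = sigma i -> edge_set (L i j) (U i j) (P i j)) /\
       (j <> sigma i -> vertex_set (L i j) (U i j) (P i j))].

Definition testing_set BL BU DL DU : set ('M[{poly R}]_n * 'M[{poly R}]_n) :=
  [set BD | (edge_mx BL BU `*` edge_mx DL DU) BD /\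
     exists eta : 'I_n -> 'I_n, forall i j,
       let BV := vertex_set (BL i j) (BU i j) in
       let BE := edge_set (BL i j) (BU i j) in
       let DV := vertex_set (DL i j) (DU i j) in
       let DE := edge_set (DL i j) (DU i j) in
       let bd := (BD.1 i j, BD.2 i j) in
       (j = eta i -> ((BE `*` DV) `|` (BV `*` DE)) bd) /\
       (j <> eta i -> (BV `*` DV) bd)].

Definition mx_family (A C : 'M[{poly R}]_n) BL BU DL DU : set 'M[{poly R}]_n :=
  [set P | exists B D, [/\ interval_mx BL BU B, interval_mx DL DU D
     & P = B *m A + D *m C]].

(* The common N is fixed before the member of the family; M_N may vary with the
   member. *)
Definition nonsingular_leading (F : set 'M[{poly R}]_n) : Prop :=
  exists N : nat, forall P, F P ->
    exists2 M : 'I_N.+1 -> 'M[R]_n,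
      P = \sum_(k < N.+1) 'X^k *: map_mx polyC (M k) & \det (M ord_max) != 0.

End IntervalMatrix.

(* Main.v *)
(* By zero exclusion (the degree of the determinant is constant on the family),
   instability spreads from a vertex matrix to the imaginary axis: some member of
   the family is singular at a point [i w]. The values at [i w] of an interval
   polynomial fill a rectangle with the Kharitonov polynomials as corners, so every
   entry can be replaced by a Kharitonov polynomial moved along the two sides of
   its rectangle. This leaves a family with two parameters in [0, 1] per entry,
   and we take an unstable member with as few parameters in ]0, 1[ as possible.
   Writing [B A + D C] as the product of [row_mx B D] and [col_mx A C], its
   determinant is, up to the identity of a Schur complement, that of a matrix of
   which the entries of [row_mx B D] are entries; hence it is jointly affine in
   two parameters sitting in the same row, or in the same column, of
   [row_mx B D]. The edge theorem for a square of polynomials then moves one of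
   the two parameters to 0 or 1. So in the minimal member each row and
   each column of [row_mx B D] has at most one parameter in ]0, 1[, which puts it
   in the testing set. *)
Require Import Defs.
From mathcomp Require Import all_boot all_order all_algebra all_fingroup.
From mathcomp Require Import all_classical all_reals.
From mathcomp Require Import complex ring lra.
From mathcomp Require Import topology normedtype derive.

Import Order.TTheory GRing.Theory Num.Theory numFieldNormedType.Exports.

Set Implicit Arguments.
Unset Strict Implicit.
Unset Printing Implicit Defensive.

Local Open Scope classical_set_scope.
Local Open Scope ring_scope.

(** * Complex values and roots of real polynomials *)

Definition ceval (R : realType) (p : {poly R}) (x y : R) : R[i] :=
  (map_poly (real_complex R) p).[Complex x y].

(** Horner induction, with the product by $x + iy$ split into real and imaginary parts so that only
    the topology of [R] enters. *)
Lemma ceval_continuous (R : realType) (T : topologicalType) (p : {poly R})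
    (X Y : T -> R) :
  continuous X -> continuous Y ->
  continuous (fun t => complex.Re (ceval p (X t) (Y t))) /\
  continuous (fun t => complex.Im (ceval p (X t) (Y t))).
Proof.
move=> cX cY; rewrite /ceval.
elim/poly_ind: p => [|p c [cRe cIm]].
  by rewrite rmorph0; split=> t; under eq_fun do rewrite horner0;
     exact: cst_continuous.
set q := map_poly _ p in cRe cIm *.
rewrite rmorphD rmorphM /= map_polyX map_polyC -/q /=.
split.
  rewrite (_ : (fun _ => _) = fun t => complex.Re q.[Complex (X t) (Y t)] * X t -
      complex.Im q.[Complex (X t) (Y t)] * Y t + c); last first.
    by apply/funext => t; rewrite hornerMXaddC; case: (q.[_]).
  move=> t; apply: cvgD; last exact: cvg_cst.
  by apply: cvgB; apply: cvgM; [exact: cRe|exact: cX|exact: cIm|exact: cY].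
rewrite (_ : (fun _ => _) = fun t => complex.Re q.[Complex (X t) (Y t)] * Y t +
    complex.Im q.[Complex (X t) (Y t)] * X t); last first.
  by apply/funext => t; rewrite hornerMXaddC; case: (q.[_]) => u v /=;
    rewrite addr0.
move=> t.
by apply: cvgD; apply: cvgM; [exact: cRe|exact: cY|exact: cIm|exact: cX].
Qed.

(** Cauchy's bound, with [c] and [S] standing for estimates of the coefficients so that one bound
    serves a whole family. *)
Lemma root_norm_le (F : numFieldType) (p : {poly F}) (d : nat) (c S : F) (z : F) :
  size p = d.+1 -> 0 < c -> c <= `|p`_d| -> \sum_(k < d) `|p`_k| <= S ->
  root p z -> `|z| <= 1 + S / c.
Proof.
move=> sp c0 cp Sp /rootP; rewrite horner_coef sp big_ord_recr /= => z0.
have S0 : 0 <= S by apply: le_trans Sp; exact: sumr_ge0.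
have Sc0 : 0 <= S / c by rewrite divr_ge0 // ltW.
case: (real_leP (normr_real z) (real1 F)) => z1.
  by rewrite (le_trans z1) // lerDl.
rewrite (@le_trans _ _ (S / c)) ?lerDr // ler_pdivlMr //.
(* A nonzero constant has no root. In positive degree the leading term is bounded by the others,
   whose powers of [|z|] are at most [|z| ^+ d] because [|z| > 1]. *)
case: d => [|d] in sp cp Sp z0 *.
  move: z0; rewrite big_ord0 add0r expr0 mulr1 => z0.
  by move: (lt_le_trans c0 cp); rewrite z0 normr0 ltxx.
have zp : 0 < `|z| ^+ d by rewrite exprn_gt0 // (lt_trans ltr01).
rewrite -(ler_pM2r zp) mulrAC -exprS.
have -> : S * `|z| ^+ d = `|z| ^+ d * S by rewrite mulrC.
apply: (@le_trans _ _ `|p`_d.+1 * z ^+ d.+1|).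
  by rewrite normrM normrX mulrC ler_wpM2r // exprn_ge0.
move/eqP: z0; rewrite addrC addr_eq0 => /eqP ->; rewrite normrN.
apply: le_trans (ler_norm_sum _ _ _) _.
apply: le_trans (_ : _ <= `|z| ^+ d * \sum_(k < d.+1) `|p`_k|) _; last first.
  by rewrite ler_wpM2l // ltW.
rewrite mulr_sumr ler_sum // => k _.
rewrite normrM normrX mulrC ler_wpM2r //.
by rewrite ler_weXn2l ?(ltW z1) // -ltnS.
Qed.

(** * Compactness of the unstable roots of a two-parameter affine family *)

Section AffineFamily.
Variables (R : realType) (f0 f1 f2 : {poly R}) (d : nat).
Hypothesis size_family : forall a b : R, 0 <= a <= 1 -> 0 <= b <= 1 ->
  size (f0 + a *: f1 + b *: f2) = d.+1.

(** The leading coefficient does not vanish on the compact square, so its modulus has a positive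
    minimum there; the lower coefficients are bounded since [a] and [b] are at most 1. Cauchy's
    bound is then uniform. *)
Lemma family_roots_bounded : exists M : R, forall a b x y : R,
  0 <= a <= 1 -> 0 <= b <= 1 -> ceval (f0 + a *: f1 + b *: f2) x y = 0 ->
  `|x| <= M /\ `|y| <= M.
Proof.
pose g (t : R * R) : R := `|f0`_d + t.1 * f1`_d + t.2 * f2`_d|.
have cg : continuous g.
  move=> t; apply: cvg_norm; apply: cvgD; first apply: cvgD.
  - exact: cvg_cst.
  - by apply: cvgM; [exact: cvg_fst|exact: cvg_cst].
  - by apply: cvgM; [exact: cvg_snd|exact: cvg_cst].
have cK : compact (`[(0:R), 1] `*` `[(0:R), 1]).
  by apply: compact_setX; exact: segment_compact.
have [|[a0 b0]] := compact_EVT_min _ cK (continuous_subspaceT cg).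
  by exists (0, 0); split; rewrite /= in_itv /= lexx ler01.
rewrite inE => -[/=]; rewrite !in_itv /= => a01 b01 gmin.
have coefF a b k : (f0 + a *: f1 + b *: f2)`_k = f0`_k + a * f1`_k + b * f2`_k.
  by rewrite !coefD !coefZ.
have c_gt0 : 0 < g (a0, b0).
  rewrite /g normr_gt0 /= -coefF.
  have -> : d = (size (f0 + a0 *: f1 + b0 *: f2)).-1 by rewrite size_family.
  by rewrite -lead_coefE lead_coef_eq0 -size_poly_gt0 size_family.
set c := g (a0, b0) in gmin c_gt0.
pose S := \sum_(k < d) (`|f0`_k| + `|f1`_k| + `|f2`_k|).
exists (1 + S / c) => a b x y a1 b1 z0.
have : `|Complex x y| <= 1 + S%:C%C / c%:C%C.
  apply: (@root_norm_le _ (map_poly (real_complex R) (f0 + a *: f1 + b *: f2)) d).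
  - by rewrite size_map_poly size_family.
  - by rewrite ltcR.
  - rewrite coef_map normc_def /= expr0n /= addr0 lecR sqrtr_sqr coefF.
    by apply: (gmin (a, b)); rewrite inE; split; rewrite /= in_itv.
  - rewrite /S rmorph_sum /= ler_sum // => k _.
    rewrite coef_map normc_def /= expr0n /= addr0 lecR sqrtr_sqr coefF.
    apply: le_trans (ler_normD _ _) _; apply: lerD; last first.
      rewrite normrM ler_piMl // ger0_norm; by case/andP: b1.
    apply: le_trans (ler_normD _ _) _; apply: lerD => //.
    rewrite normrM ler_piMl // ger0_norm; by case/andP: a1.
  - by apply/rootP.
rewrite -fmorphV -rmorphM -(rmorph1 (real_complex R)) -rmorphD normc_def lecR /=.
move=> zM; split; apply: le_trans zM; rewrite -sqrtr_sqr ler_wsqrtr //.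
  by rewrite lerDl sqr_ge0.
by rewrite lerDr sqr_ge0.
Qed.

(* A point [(a, b, (x, y))] stands for the root [x + i y] at the parameters
   [(a, b)]. *)
Definition unstable_roots : set (R * R * (R * R)) :=
  [set t | [/\ 0 <= t.1.1 <= 1, 0 <= t.1.2 <= 1, 0 <= t.2.1 &
    ceval (f0 + t.1.1 *: f1 + t.1.2 *: f2) t.2.1 t.2.2 = 0]].

Lemma cevalF a b x y : ceval (f0 + a *: f1 + b *: f2) x y =
  ceval f0 x y + a%:C%C * ceval f1 x y + b%:C%C * ceval f2 x y.
Proof.
by rewrite /ceval !rmorphD /= !map_polyZ !hornerD !hornerZ.
Qed.

Lemma cevalF_eq0 a b x y : ceval (f0 + a *: f1 + b *: f2) x y = 0 <->
  complex.Re (ceval f0 x y) + a * complex.Re (ceval f1 x y) +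
    b * complex.Re (ceval f2 x y) = 0 /\
  complex.Im (ceval f0 x y) + a * complex.Im (ceval f1 x y) +
    b * complex.Im (ceval f2 x y) = 0.
Proof.
rewrite cevalF; case: (ceval f0 x y) => u0 v0; case: (ceval f1 x y) => u1 v1.
case: (ceval f2 x y) => u2 v2 /=.
split=> [[]|[eR eI]]; first by rewrite !mul0r !subr0 !addr0 => -> ->.
by apply/eqP; rewrite eq_complex /= !mul0r !subr0 !addr0 eR eI eqxx.
Qed.

(** The uniform root bound places the set in a compact box, where it is cut out by closed conditions
    on continuous functions. *)
Lemma unstable_roots_compact : compact unstable_roots.
Proof.
have [M MP] := family_roots_bounded.
have cK : compact ((`[(0:R), 1] `*` `[(0:R), 1]) `*` (`[-M, M] `*` `[-M, M])).
  by apply: compact_setX; apply: compact_setX; exact: segment_compact.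
apply: subclosed_compact cK _; last first.
  move=> [[a b] [x y]] [/= a01 b01 x0 z0]; have [xM yM] := MP _ _ _ _ a01 b01 z0.
  by split; split; rewrite /= in_itv //= -ler_norml.
have c11 : continuous (fun t : R * R * (R * R) => t.1.1).
  by move=> t; apply: (@continuous_comp _ _ _ fst fst t);
    [exact: cvg_fst|exact: cvg_fst].
have c12 : continuous (fun t : R * R * (R * R) => t.1.2).
  by move=> t; apply: (@continuous_comp _ _ _ fst snd t);
    [exact: cvg_fst|exact: cvg_snd].
have c21 : continuous (fun t : R * R * (R * R) => t.2.1).
  by move=> t; apply: (@continuous_comp _ _ _ snd fst t);
    [exact: cvg_snd|exact: cvg_fst].
have c22 : continuous (fun t : R * R * (R * R) => t.2.2).
  by move=> t; apply: (@continuous_comp _ _ _ snd snd t);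
    [exact: cvg_snd|exact: cvg_snd].
have [cR0 cI0] := ceval_continuous f0 c21 c22.
have [cR1 cI1] := ceval_continuous f1 c21 c22.
have [cR2 cI2] := ceval_continuous f2 c21 c22.
pose re (t : R * R * (R * R)) := complex.Re (ceval f0 t.2.1 t.2.2) +
  t.1.1 * complex.Re (ceval f1 t.2.1 t.2.2) +
  t.1.2 * complex.Re (ceval f2 t.2.1 t.2.2).
pose im (t : R * R * (R * R)) := complex.Im (ceval f0 t.2.1 t.2.2) +
  t.1.1 * complex.Im (ceval f1 t.2.1 t.2.2) +
  t.1.2 * complex.Im (ceval f2 t.2.1 t.2.2).
have cre : continuous re.
  move=> t; apply: cvgD; first apply: cvgD; first exact: cR0.
    by apply: cvgM; [exact: c11|exact: cR1].
  by apply: cvgM; [exact: c12|exact: cR2].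
have cim : continuous im.
  move=> t; apply: cvgD; first apply: cvgD; first exact: cI0.
    by apply: cvgM; [exact: c11|exact: cI1].
  by apply: cvgM; [exact: c12|exact: cI2].
rewrite (_ : unstable_roots = (fun t => t.1.1) @^-1` [set x | 0 <= x] `&`
  (fun t => t.1.1) @^-1` [set x | x <= 1] `&`
  (fun t => t.1.2) @^-1` [set x | 0 <= x] `&`
  (fun t => t.1.2) @^-1` [set x | x <= 1] `&`
  (fun t => t.2.1) @^-1` [set x | 0 <= x] `&`
  re @^-1` [set x | x = 0] `&` im @^-1` [set x | x = 0]).
  by do !apply: closedI; apply: (continuous_closedP _).1 => //;
    solve [exact: closed_ge|exact: closed_le|exact: closed_eq].
apply/seteqP; split=> -[[a b] [x y]]; rewrite /unstable_roots /re /im /=.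
  by move=> [/andP[-> ->] /andP[-> ->] -> /cevalF_eq0[-> ->]].
by move=> [[[[[[-> ->] ->] ->] ->] eR] eI]; split=> //; apply/cevalF_eq0.
Qed.

Lemma unstable_roots_max (g : R * R * (R * R) -> R) :
  continuous g -> unstable_roots !=set0 ->
  exists2 t, unstable_roots t & forall t', unstable_roots t' -> g t' <= g t.
Proof.
move=> cg K0.
have [t] := compact_EVT_max K0 unstable_roots_compact (continuous_subspaceT cg).
by rewrite inE => Kt tmax; exists t => // t' Kt'; apply: tmax; rewrite inE.
Qed.

End AffineFamily.

(** * The edge theorem for a square of polynomials *)

Lemma not_stableP (R : realType) (p : {poly R}) :
  ~ stable_poly p <-> exists x y, 0 <= x /\ ceval p x y = 0.
Proof.
split=> [|[x [y [x0 pz0]]] /(_ (Complex x y))]; last first.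
  by rewrite /root -/(ceval p x y) pz0 eqxx => /(_ isT) /=; rewrite ltNge x0.
move=> /existsNP[[x y]] /not_implyP[/rootP pz0] /negP /=; rewrite -leNgt => x0.
by exists x, y.
Qed.

Lemma unit_not_interior (R : realDomainType) (a : R) :
  0 <= a <= 1 -> ~~ (0 < a < 1) -> a = 0 \/ a = 1.
Proof.
move=> /andP[a0 a1]; rewrite !lt_def a0 a1 !andbT negb_and !negbK.
by case/orP => /eqP; [left|right].
Qed.

(** [t] is the time at which a point starting at [a] with velocity [p] reaches 0 (if [p < 0]) or 1
    (if [p > 0]). *)
Lemma unit_segment_exit (R : realFieldType) (a p : R) : 0 < a < 1 -> p != 0 ->
  exists2 t, 0 <= t & (a + t * p = 0 \/ a + t * p = 1) /\
    forall s, 0 <= s <= t -> 0 <= a + s * p <= 1.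
Proof.
move=> /andP[a0 a1]; rewrite neq_lt => /orP[p0|p0].
  have tp : - a / p * p = - a by rewrite divfK // lt_eqF.
  exists (- a / p); first by rewrite ler_ndivlMr // mul0r; lra.
  by rewrite tp; split=> [|s /andP[s0 st]]; [left; lra|nra].
have tp : (1 - a) / p * p = 1 - a by rewrite divfK // gt_eqF.
exists ((1 - a) / p); first by rewrite divr_ge0 //; lra.
by rewrite tp; split=> [|s /andP[s0 st]]; [right; lra|nra].
Qed.

(** The earlier of the exit times of the two coordinates works; a coordinate with velocity 0 never
    exits. *)
Lemma unit_square_exit (R : realFieldType) (a b p q : R) :
  0 < a < 1 -> 0 < b < 1 -> (p != 0) || (q != 0) ->
  exists t, [/\ 0 <= a + t * p <= 1, 0 <= b + t * q <= 1 &
    [\/ a + t * p = 0, a + t * p = 1, b + t * q = 0 | b + t * q = 1]].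
Proof.
move=> a01 b01; have [->|p0 _] := eqVneq p 0; rewrite ?eqxx /=.
  move=> q0; have [t t0 [bt bs]] := unit_segment_exit b01 q0.
  exists t; rewrite mulr0 addr0; split; first lra.
    by apply: bs; rewrite t0 lexx.
  by case: bt => ->; [constructor 3|constructor 4].
have [t t0 [at_ as_]] := unit_segment_exit a01 p0.
have [->|q0] := eqVneq q 0.
  exists t; rewrite mulr0 addr0; split; last 1 first.
  - by case: at_ => ->; [constructor 1|constructor 2].
  - by apply: as_; rewrite t0 lexx.
  - lra.
have [t' t'0 [bt' bs']] := unit_segment_exit b01 q0.
case: (lerP t t') => tt'.
  exists t; split; [by apply: as_; lra|by apply: bs'; lra|].
  by case: at_ => ->; [constructor 1|constructor 2].
exists t'; split; [by apply: as_; lra|by apply: bs'; lra|].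
by case: bt' => ->; [constructor 3|constructor 4].
Qed.

(* A root [x + i y] of maximal real part lies over a boundary point of the
   square: over an interior point, either the values of [f1] and [f2] at the
   root are independent over the reals, and Cramer's rule yields parameters for
   which [x + e + i y] is a root, or they are dependent, and the parameters can
   be moved up to the boundary without moving the root. *)
Lemma square_boundary_unstable (R : realType) (f0 f1 f2 : {poly R}) (d : nat)
    (a b : R) :
  (forall a b : R, 0 <= a <= 1 -> 0 <= b <= 1 ->
    size (f0 + a *: f1 + b *: f2) = d.+1) ->
  0 <= a <= 1 -> 0 <= b <= 1 -> ~ stable_poly (f0 + a *: f1 + b *: f2) ->
  exists a' b', [/\ 0 <= a' <= 1, 0 <= b' <= 1,
    [\/ a' = 0, a' = 1, b' = 0 | b' = 1] &
    ~ stable_poly (f0 + a' *: f1 + b' *: f2)].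
Proof.
move=> size_family a01 b01 /not_stableP[x [y [x0 z0]]].
have cg : continuous (fun t : R * R * (R * R) => t.2.1).
  by move=> t; apply: (@continuous_comp _ _ _ snd fst t);
    [exact: cvg_snd|exact: cvg_fst].
have [|[[{a01}a {b01}b] [{x0 z0}x {}y]]] := unstable_roots_max size_family cg.
  by exists (a, b, (x, y)).
rewrite /unstable_roots /= => -[a01 b01 x0 z0 xmax].
have [a_int|/(unit_not_interior a01) a_bd] := boolP (0 < a < 1); last first.
  exists a, b; split=> //; last by apply/not_stableP; exists x, y.
  by case: a_bd => ->; [constructor 1|constructor 2].
have [b_int|/(unit_not_interior b01) b_bd] := boolP (0 < b < 1); last first.
  exists a, b; split=> //; last by apply/not_stableP; exists x, y.
  by case: b_bd => ->; [constructor 3|constructor 4].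
(* Moving the parameters in a direction [(p, q)] that annihilates the values of [f1] and [f2] keeps
   the root fixed up to the boundary. *)
have along p q : (p != 0) || (q != 0) ->
    p * complex.Re (ceval f1 x y) + q * complex.Re (ceval f2 x y) = 0 ->
    p * complex.Im (ceval f1 x y) + q * complex.Im (ceval f2 x y) = 0 ->
    exists a' b', [/\ 0 <= a' <= 1, 0 <= b' <= 1,
      [\/ a' = 0, a' = 1, b' = 0 | b' = 1] &
      ~ stable_poly (f0 + a' *: f1 + b' *: f2)].
  move=> pq0 eR eI; have [t [at01 bt01 bd]] := unit_square_exit a_int b_int pq0.
  exists (a + t * p), (b + t * q); split=> //.
  apply/not_stableP; exists x, y; split=> //.
  move/cevalF_eq0: z0 => [zR zI]; apply/cevalF_eq0; split.
    by rewrite -[RHS]zR -[RHS]addr0 -(mulr0 t) -eR; ring.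
  by rewrite -[RHS]zI -[RHS]addr0 -(mulr0 t) -eI; ring.
pose u0 s := complex.Re (ceval f0 s y); pose v0 s := complex.Im (ceval f0 s y).
pose u1 s := complex.Re (ceval f1 s y); pose v1 s := complex.Im (ceval f1 s y).
pose u2 s := complex.Re (ceval f2 s y); pose v2 s := complex.Im (ceval f2 s y).
pose D s := u1 s * v2 s - u2 s * v1 s.
(* If the Cramer determinant vanishes, [(u2, - u1)] is such a direction, or [(v2, - v1)] if that
   vector is zero; if both are zero, [(1, 0)] will do. *)
have [Dx|Dx] := eqVneq (D x) 0.
  have [e1|n1] := boolP ((u2 x != 0) || (- u1 x != 0)).
    apply: (along _ _ e1); first by rewrite /u1 /u2; ring.
    by move: Dx; rewrite /D /u1 /u2 /v1 /v2 => Dx; rewrite -[RHS]oppr0 -Dx; ring.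
  move: n1; rewrite negb_or !negbK oppr_eq0 => /andP[/eqP u2x /eqP u1x].
  have [e1|n1] := boolP ((v2 x != 0) || (- v1 x != 0)).
    apply: (along _ _ e1); last by rewrite /v1 /v2; ring.
    by rewrite -/(u1 x) -/(u2 x) u1x u2x !mulr0 addr0.
  move: n1; rewrite negb_or !negbK oppr_eq0 => /andP[/eqP v2x /eqP v1x].
  apply: (along 1 0); first by rewrite oner_eq0.
    by rewrite -/(u1 x) -/(u2 x) u1x u2x !mulr0 addr0.
  by rewrite -/(v1 x) -/(v2 x) v1x v2x !mulr0 addr0.
have cid : continuous (fun s : R => s) by move=> s; exact: cvg_id.
have cy : continuous (fun s : R => y) by move=> s; exact: cvg_cst.
have [cu0 cv0] := ceval_continuous f0 cid cy.
have [cu1 cv1] := ceval_continuous f1 cid cy.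
have [cu2 cv2] := ceval_continuous f2 cid cy.
(* Cramer's solution for the parameters at which [s + i y] is a root; at [s = x] it is [(a, b)]. *)
pose al s := (u2 s * v0 s - u0 s * v2 s) / D s.
pose be s := (u0 s * v1 s - u1 s * v0 s) / D s.
move/cevalF_eq0: z0 => [zR zI].
rewrite -/(u0 x) -/(u1 x) -/(u2 x) in zR; rewrite -/(v0 x) -/(v1 x) -/(v2 x) in zI.
have alx : al x = a.
  apply: (mulIf Dx); rewrite divfK // /D.
  have -> : u0 x = - (a * u1 x + b * u2 x) by lra.
  have -> : v0 x = - (a * v1 x + b * v2 x) by lra.
  ring.
have bex : be x = b.
  apply: (mulIf Dx); rewrite divfK // /D.
  have -> : u0 x = - (a * u1 x + b * u2 x) by lra.
  have -> : v0 x = - (a * v1 x + b * v2 x) by lra.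
  ring.
have cD : {for x, continuous D}.
  by apply: cvgB; apply: cvgM; [exact: cu1|exact: cv2|exact: cu2|exact: cv1].
have cal : {for x, continuous al}.
  apply: cvgM; last exact: cvgV.
  by apply: cvgB; apply: cvgM; [exact: cu2|exact: cv0|exact: cu0|exact: cv2].
have cbe : {for x, continuous be}.
  apply: cvgM; last exact: cvgV.
  by apply: cvgB; apply: cvgM; [exact: cu0|exact: cv1|exact: cu1|exact: cv0].
have nearU (g : R -> R) (A : set R) : {for x, continuous g} -> open A ->
    A (g x) -> \forall s \near x, A (g s).
  by move=> cg' oA Ag; apply: cg'; exact: open_nbhs_nbhs.
have n1 : \forall s \near x, D s != 0.
  by apply: (nearU D [set w | w != 0]) => //; exact: open_neq.
have n2 : \forall s \near x, 0 < al s.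
  by apply: (nearU al [set w | 0 < w]) => //; rewrite /= alx;
    case/andP: a_int.
have n3 : \forall s \near x, al s < 1.
  by apply: (nearU al [set w | w < 1]) => //; rewrite /= alx;
    case/andP: a_int.
have n4 : \forall s \near x, 0 < be s.
  by apply: (nearU be [set w | 0 < w]) => //; rewrite /= bex;
    case/andP: b_int.
have n5 : \forall s \near x, be s < 1.
  by apply: (nearU be [set w | w < 1]) => //; rewrite /= bex;
    case/andP: b_int.
have : \forall s \near x, [/\ D s != 0, 0 < al s < 1 & 0 < be s < 1].
  near=> s; split; first by near: s.
    by apply/andP; split; near: s.
  by apply/andP; split; near: s.
move=> /nbhs_ballP[e /= e0 He].
(* Half the radius stays inside the open ball; the root found there contradicts the maximality of
   [x]. *)
have [|Ds als bes] := He (x + e / 2).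
  rewrite /ball /= opprD addrA subrr sub0r normrN gtr0_norm; last by lra.
  lra.
have := xmax (al (x + e / 2), be (x + e / 2), (x + e / 2, y)).
have : x < x + e / 2 by lra.
rewrite ltNge => /negP xe /=; case/(_ _)/xe; split; [lra|lra|lra|].
apply/cevalF_eq0; set s := x + e / 2 in Ds *.
rewrite -/(u0 s) -/(u1 s) -/(u2 s) -/(v0 s) -/(v1 s) -/(v2 s) /al /be.
by move: Ds; rewrite /D => Ds; split; field.
Unshelve. all: by end_near.
Qed.

(** * Crossing of the imaginary axis *)

(** Over a closed field [p] splits into [d] linear factors, each of modulus at least [c] at [z]. *)
Lemma norm_horner_ge (F : numClosedFieldType) (p : {poly F}) (d : nat) (z c : F) :
  size p = d.+1 -> 0 <= c -> (forall r, root p r -> c <= `|z - r|) ->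
  `|p`_d| * c ^+ d <= `|p.[z]|.
Proof.
move=> sp c0 rc; have [rs pE] := closed_field_poly_normal p.
have lp : lead_coef p = p`_d by rewrite lead_coefE sp.
have l0 : p`_d != 0 by rewrite -lp lead_coef_eq0 -size_poly_gt0 sp.
have sz : size rs = d.
  have := sp; rewrite pE lp size_scale //.
  by rewrite size_prod_XsubC => -[].
have {}rc r : r \in rs -> c <= `|z - r|.
  by move=> rrs; apply: rc; rewrite pE lp rootZ // root_prod_XsubC.
have -> : p.[z] = p`_d * \prod_(r <- rs) ('X - r%:P).[z].
  by rewrite {1}pE lp hornerZ horner_prod.
rewrite normrM ler_wpM2l // -sz normr_prod.
elim: rs {pE sz} rc => [|r rs IH] rc; first by rewrite big_nil expr0.
rewrite big_cons exprS ler_pM ?exprn_ge0 //.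
  by rewrite hornerXsubC rc // mem_head.
by apply: IH => r' r'rs; rewrite rc // in_cons r'rs orbT.
Qed.

(* At the least parameter with a root in the closed right half plane, such a
   root lies on the imaginary axis: for all smaller parameters the roots stay at
   distance at least its real part. *)
Lemma imaginary_crossing (R : realType) (p q : {poly R}) (d : nat) :
  (forall a : R, 0 <= a <= 1 -> size (p + a *: q) = d.+1) ->
  stable_poly p -> ~ stable_poly (p + q) ->
  exists a y, 0 <= a <= 1 /\ ceval (p + a *: q) 0 y = 0.
Proof.
move=> size_pq stp /not_stableP[x1 [y1 [x10 z1]]].
(* The one-parameter family is treated as a square with [f2 = 0]; maximizing [- a] then yields the
   least unstable parameter. *)
have szF : forall a b : R, 0 <= a <= 1 -> 0 <= b <= 1 ->
  size (p + a *: q + b *: 0) = d.+1.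
  by move=> a b a01 _; rewrite scaler0 addr0 size_pq.
have cg : continuous (fun t : R * R * (R * R) => - t.1.1).
  move=> t; apply: cvgN; apply: (@continuous_comp _ _ _ fst fst t);
    exact: cvg_fst.
have [|[[a b] [x y]]] := unstable_roots_max szF cg.
  by exists (1, 0, (x1, y1)); split; rewrite /= ?lexx ?ler01 // scale1r scaler0 addr0.
rewrite /unstable_roots /= => -[a01 _ x0 z0 amin].
rewrite scaler0 addr0 in z0.
exists a, y; split=> //.
have [xE|xn0] := eqVneq x 0; [by rewrite xE in z0|exfalso].
have xp : 0 < x by rewrite lt_def xn0.
have stab s : 0 <= s < a -> stable_poly (p + s *: q).
  move=> /andP[s0 sa]; apply: contrapT => /not_stableP[x' [y' [x'0 z'0]]].
  have := amin (s, 0, (x', y')); rewrite /= scaler0 addr0 lerN2.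
  have -> : (a <= s) = false by rewrite leNgt sa.
  by case/(_ _)/notF; split=> //; rewrite ?lexx ?ler01 // s0 (le_trans (ltW sa)) //;
    case/andP: a01.
have ap : 0 < a.
  rewrite lt_def; case/andP: a01 => -> _; rewrite andbT; apply/eqP => a0.
  have : ~ stable_poly p.
    by apply/not_stableP; exists x, y; split=> //; rewrite -z0 a0 scale0r addr0.
  by apply.
have sz0 : (p + a *: q)`_d != 0.
  have -> : d = (size (p + a *: q)).-1 by rewrite size_pq.
  by rewrite -lead_coefE lead_coef_eq0 -size_poly_gt0 size_pq.
set l := (p + a *: q)`_d in sz0.
pose L := `|l| * x ^+ d.
have Lp : 0 < L by rewrite mulr_gt0 ?normr_gt0 // exprn_gt0.
pose Q := complex.Re `|ceval q x y|.
have QE : `|ceval q x y| = Q%:C%C by rewrite /Q normc_def.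
have Q0 : 0 <= Q by rewrite -ler0c -QE.
pose K := `|q`_d| * x ^+ d + Q.
have K0 : 0 <= K by rewrite addr_ge0 // mulr_ge0 // exprn_ge0 // ltW.
(* At [s = a - e] the polynomial is stable, so its roots are at distance at least [x] from the root
   [x + i y] at [a], where its value is only [- e] times that of [q]. Replacing its leading
   coefficient by [l] costs a further multiple of [e]. *)
have key e : 0 < e <= a -> L <= e * K.
  move=> /andP[e0 ea]; pose s := a - e.
  have s_int : 0 <= s < a by rewrite /s; lra.
  have s01 : 0 <= s <= 1 by rewrite /s; lra.
  have := @norm_horner_ge _ (map_poly (real_complex R) (p + s *: q)) d
    (Complex x y) x%:C%C.
  rewrite size_map_poly size_pq // ler0c x0 coef_map => /(_ erefl isT).
  have -> : (map_poly (real_complex R) (p + s *: q)).[Complex x y] =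
      - (e%:C%C * ceval q x y).
    have -> : p + s *: q = p + a *: q - e *: q.
      by rewrite /s scalerBl addrA.
    rewrite rmorphB /= map_polyZ hornerD hornerN hornerZ -/(ceval _ x y) z0.
    by rewrite sub0r.
  rewrite normrN normrM QE normc_def /= expr0n /= addr0 sqrtr_sqr.
  rewrite [`|e%:C%C|]normc_def /= expr0n /= addr0 sqrtr_sqr (ger0_norm (ltW e0)).
  rewrite -rmorphXn -!rmorphM lecR /= => ineq.
  have {}ineq : `|(p + s *: q)`_d| * x ^+ d <= e * Q.
    apply: ineq => -[u v] /(stab _ s_int (Complex u v)) /= u0.
    apply: le_trans (normc_ge_Re _); rewrite lecR /=.
    by rewrite ger0_norm; lra.
  have : L <= (`|(p + s *: q)`_d| + e * `|q`_d|) * x ^+ d.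
    rewrite /L ler_wpM2r // ?exprn_ge0 //.
    have -> : l = (p + s *: q)`_d + e * q`_d.
      by rewrite /l /s !coefD !coefZ; ring.
    by rewrite (le_trans (ler_normD _ _)) // normrM (ger0_norm (ltW e0)).
  by rewrite /K; move: ineq; lra.
(* The smaller of [a] and [L / (K + 1)] violates [key]; the added 1 keeps the denominator
   positive. *)
have K1 : 0 < K + 1 by lra.
have e1 : 0 < L / (K + 1) by rewrite divr_gt0.
case: (lerP a (L / (K + 1))) => aL.
  have : a * (K + 1) <= L by rewrite -ler_pdivlMr.
  have := key a; rewrite ap lexx => /(_ isT).
  nra.
have := key (L / (K + 1)); rewrite e1 (ltW aL) => /(_ isT).
have : L / (K + 1) * (K + 1) = L by rewrite divfK // gt_eqF.
nra.
Qed.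

(** * Kharitonov rectangles *)

(** Links the period 4 of the Kharitonov pattern to the powers of $i$: the parity of [k] tells real
    from imaginary, that of [k./2] gives the sign. *)
Lemma mod4_cases (k : nat) :
  [\/ [/\ (k %% 4 = 0)%N, ~~ odd k & ~~ odd k./2],
      [/\ (k %% 4 = 1)%N, odd k & ~~ odd k./2],
      [/\ (k %% 4 = 2)%N, ~~ odd k & odd k./2] |
      [/\ (k %% 4 = 3)%N, odd k & odd k./2]].
Proof.
have kE := odd_double_half k; have hE := odd_double_half k./2.
have -> : (k %% 4 = odd k + (odd k./2).*2)%N.
  rewrite -{1}kE -{1}hE doubleD addnA -muln2 -!muln2 -mulnA addnC modnMDl.
  by rewrite modn_small //; case: (odd k); case: (odd k./2).
case: (odd k); case: (odd k./2).
- by constructor 4.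
- by constructor 2.
- by constructor 3.
- by constructor 1.
Qed.

(** [t] is the quotient of the two sums; it locates the even or odd part of an interval polynomial
    on a side of its rectangle. *)
Lemma weighted_mean (R : realFieldType) (I : finType) (P : pred I)
    (e D c : I -> R) :
  (forall k, 0 <= e k <= D k) -> (forall k, 0 <= c k) ->
  exists2 t, 0 <= t <= 1 &
    \sum_(k | P k) e k * c k = t * \sum_(k | P k) D k * c k.
Proof.
move=> eD c0; set S := \sum_(k | P k) D k * c k; set s := \sum_(k | P k) _.
have s0 : 0 <= s.
  by apply: sumr_ge0 => k _; rewrite mulr_ge0 //; case/andP: (eD k).
have sS : s <= S.
  by apply: ler_sum => k _; rewrite ler_wpM2r //; case/andP: (eD k).
(* If the larger sum is 0, so is the smaller, and [t = 0] will do. *)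
have [S0|S0] := eqVneq S 0.
  by exists 0; rewrite ?lexx ?ler01 // mul0r; lra.
have Sp : 0 < S by rewrite lt_def S0 (le_trans s0).
exists (s / S); last by rewrite divfK.
by apply/andP; split; [rewrite divr_ge0 // ltW|rewrite ler_pdivrMr // mul1r].
Qed.

Section KharitonovRectangle.
Variables (R : realType) (m : nat) (L U : 'I_m.+1 -> R).
Hypothesis leLU : forall k, L k <= U k.
Implicit Types (l u y : R) (r e : 'I_m.+1 -> R).

Lemma poly_of_coefsD r e :
  poly_of_coefs r + poly_of_coefs e = poly_of_coefs (fun k => r k + e k).
Proof. by rewrite -big_split; apply: eq_bigr => k _; rewrite scalerDl. Qed.

Lemma poly_of_coefsZ a r :
  a *: poly_of_coefs r = poly_of_coefs (fun k => a * r k).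
Proof. by rewrite scaler_sumr; apply: eq_bigr => k _; rewrite scalerA. Qed.

Lemma poly_of_coefsB r e :
  poly_of_coefs r - poly_of_coefs e = poly_of_coefs (fun k => r k - e k).
Proof. by rewrite -sumrB; apply: eq_bigr => k _; rewrite scalerBl. Qed.

Lemma eq_poly_of_coefs r e : r =1 e -> poly_of_coefs r = poly_of_coefs e.
Proof. by move=> re; apply: eq_bigr => k _; rewrite re. Qed.

(** [kharitonov1] and [kharitonov3] differ in even degrees only, [kharitonov1] and [kharitonov2] in
    odd degrees only: [l] moves the even part and [u] the odd part. *)
Definition kharitonov_point l u : {poly R} :=
  kharitonov1 L U + l *: (kharitonov3 L U - kharitonov1 L U)
                  + u *: (kharitonov2 L U - kharitonov1 L U).

Lemma kharitonov4E :
  kharitonov4 L U = kharitonov3 L U + (kharitonov2 L U - kharitonov1 L U).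
Proof.
rewrite poly_of_coefsB poly_of_coefsD; apply: eq_poly_of_coefs => k.
by have [] := mod4_cases k => -[-> _ _]; rewrite !inE /=; ring.
Qed.

Lemma kharitonov_point00 : kharitonov_point 0 0 = kharitonov1 L U.
Proof. by rewrite /kharitonov_point !scale0r !addr0. Qed.

Lemma kharitonov_point01 : kharitonov_point 0 1 = kharitonov2 L U.
Proof. by rewrite /kharitonov_point scale0r scale1r addr0 addrC subrK. Qed.

Lemma kharitonov_point10 : kharitonov_point 1 0 = kharitonov3 L U.
Proof. by rewrite /kharitonov_point scale0r scale1r addr0 addrC subrK. Qed.

Lemma kharitonov_point11 : kharitonov_point 1 1 = kharitonov4 L U.
Proof.
by rewrite /kharitonov_point !scale1r kharitonov4E [_ + (kharitonov3 _ _ - _)]addrC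
  subrK.
Qed.

(** Each coefficient depends on only one of [l] and [u], as a convex combination of its two
    bounds. *)
Lemma kharitonov_point_interval l u : 0 <= l <= 1 -> 0 <= u <= 1 ->
  interval_poly L U (kharitonov_point l u).
Proof.
move=> l01 u01; rewrite /kharitonov_point !poly_of_coefsB !poly_of_coefsZ.
rewrite !poly_of_coefsD; eexists; last reflexivity.
move=> k /=; have := leLU k.
by have [] := mod4_cases k => -[-> _ _]; rewrite !inE /= => LU; nra.
Qed.

Lemma kharitonov_point_vertex l u : l = 0 \/ l = 1 -> u = 0 \/ u = 1 ->
  vertex_set L U (kharitonov_point l u).
Proof.
rewrite /vertex_set /=; case=> ->; case=> ->.
- by rewrite kharitonov_point00; left; left; left.
- by rewrite kharitonov_point01; left; left; right.
- by rewrite kharitonov_point10; left; right.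
- by rewrite kharitonov_point11; right.
Qed.

(** The four sides of the parameter square correspond to the four index pairs: [l = 0] to (1,2),
    [u = 1] to (2,4), [l = 1] to (4,3), [u = 0] to (3,1). *)
Lemma kharitonov_point_edge l u : 0 <= l <= 1 -> 0 <= u <= 1 ->
  [\/ l = 0, l = 1, u = 0 | u = 1] -> edge_set L U (kharitonov_point l u).
Proof.
move=> l01 u01; rewrite /edge_set /kharitonov_point kharitonov4E; case=> ->.
- left; left; left; exists (1 - u); first lra.
  by rewrite -!mul_polyC !rmorphB /= !rmorph1 !rmorph0; ring.
- left; right; exists u; first lra.
  by rewrite -!mul_polyC !rmorphB /= !rmorph1; ring.
- right; exists l; first lra.
  by rewrite -!mul_polyC !rmorphB /= !rmorph1 !rmorph0; ring.
- left; left; right; exists (1 - l); first lra.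
  by rewrite -!mul_polyC !rmorphB /= !rmorph1; ring.
Qed.

(* The sign [(-1) ^+ k./2] cancels the one of [(i y) ^+ k]. *)
Lemma ceval_imaginary (e : 'I_m.+1 -> R) y :
  ceval (poly_of_coefs (fun k => (-1) ^+ k./2 * e k)) 0 y =
  (\sum_(k < m.+1 | ~~ odd k) e k * (y ^+ 2) ^+ k./2)%:C%C +
  Complex 0 y * (\sum_(k < m.+1 | odd k) e k * (y ^+ 2) ^+ k./2)%:C%C.
Proof.
have iy2 : Complex 0 y ^+ 2 = (- (y ^+ 2))%:C%C.
  by apply/eqP; rewrite eq_complex /= expr2 !mul0r !mulr0 sub0r addr0 !eqxx.
rewrite /ceval rmorph_sum horner_sum (bigID (fun k : 'I_m.+1 => ~~ odd k)) /=.
rewrite !rmorph_sum mulr_sumr /=; congr +%R.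
  apply: eq_bigr => k ke.
  rewrite map_polyZ map_polyXn hornerZ hornerXn -{2}(odd_double_half k).
  rewrite (negbTE ke) add0n -mul2n exprM iy2 -rmorphXn -rmorphM /=.
  by rewrite (exprNn (y ^+ 2)) mulrACA -exprD addnn -mul2n exprM sqrrN expr1n
    expr1n mul1r.
rewrite (eq_bigl (fun k : 'I_m.+1 => odd k)); last by move=> k /=; rewrite negbK.
apply: eq_bigr => k ke.
rewrite map_polyZ map_polyXn hornerZ hornerXn -{2}(odd_double_half k).
rewrite ke add1n exprS -mul2n exprM iy2 mulrCA; congr (_ * _).
rewrite -rmorphXn -rmorphM /=.
by rewrite (exprNn (y ^+ 2)) mulrACA -exprD addnn -mul2n exprM sqrrN expr1n
    expr1n mul1r.
Qed.

(* The coefficients of [kharitonov1] minimize both the even part at [i y] and the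
   quotient of the odd part by [i y]; [e] is the deviation from them, made
   nonnegative by the sign of [i ^+ k]. *)
Lemma kharitonov_rectangle (p : {poly R}) y : interval_poly L U p ->
  exists l u, [/\ 0 <= l <= 1, 0 <= u <= 1 &
    ceval p 0 y = ceval (kharitonov_point l u) 0 y].
Proof.
move=> [r rLU ->]; pose D k := U k - L k.
pose e (k : 'I_m.+1) :=
  (-1) ^+ k./2 * (r k - if (k %% 4)%N \in [:: 2; 3]%N then U k else L k).
have eD k : 0 <= e k <= D k.
  have := rLU k; rewrite /e /D.
  have [] := mod4_cases k => -[-> _]; rewrite !inE /= -signr_odd.
  - by move=> /negbTE -> /=; lra.
  - by move=> /negbTE -> /=; lra.
  - by move=> -> /=; lra.
  - by move=> -> /=; lra.
have c0 (k : 'I_m.+1) : 0 <= (y ^+ 2) ^+ k./2 by rewrite exprn_ge0 // sqr_ge0.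
have [l l01 lE] := weighted_mean (fun k : 'I_m.+1 => ~~ odd k) eD c0.
have [u u01 uE] := weighted_mean (fun k : 'I_m.+1 => odd k) eD c0.
exists l, u; split=> //.
have pE : poly_of_coefs r =
    kharitonov1 L U + poly_of_coefs (fun k => (-1) ^+ k./2 * e k).
  rewrite poly_of_coefsD; apply: eq_poly_of_coefs => k.
  by rewrite /e mulrA -exprD addnn -mul2n exprM sqrrN expr1n expr1n mul1r addrC subrK.
(* This side of the rectangle is real at [i y], the next one imaginary. *)
have evenE : kharitonov3 L U - kharitonov1 L U =
    poly_of_coefs (fun k => (-1) ^+ k./2 * if odd k then 0 else D k).
  rewrite poly_of_coefsB; apply: eq_poly_of_coefs => k; rewrite /D -signr_odd.
  by have [] := mod4_cases k => -[-> o o']; rewrite !inE /= ?o ?o' ?(negbTE o)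
    ?(negbTE o') /=; ring.
have oddE : kharitonov2 L U - kharitonov1 L U =
    poly_of_coefs (fun k => (-1) ^+ k./2 * if odd k then D k else 0).
  rewrite poly_of_coefsB; apply: eq_poly_of_coefs => k; rewrite /D -signr_odd.
  by have [] := mod4_cases k => -[-> o o']; rewrite !inE /= ?o ?o' ?(negbTE o)
    ?(negbTE o') /=; ring.
rewrite cevalF evenE oddE pE /ceval rmorphD hornerD -addrA; congr +%R.
rewrite -!/(ceval _ _ _) !ceval_imaginary lE uE.
have s1 : \sum_(k < m.+1 | ~~ odd k) (if odd k then 0 else D k) * (y ^+ 2) ^+ k./2
    = \sum_(k < m.+1 | ~~ odd k) D k * (y ^+ 2) ^+ k./2.
  by apply: eq_bigr => k /negbTE ->.
have s2 : \sum_(k < m.+1 | odd k) (if odd k then 0 else D k) * (y ^+ 2) ^+ k./2 = 0.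
  by apply: big1 => k ->; rewrite mul0r.
have s3 : \sum_(k < m.+1 | ~~ odd k) (if odd k then D k else 0) * (y ^+ 2) ^+ k./2 = 0.
  by apply: big1 => k /negbTE ->; rewrite mul0r.
have s4 : \sum_(k < m.+1 | odd k) (if odd k then D k else 0) * (y ^+ 2) ^+ k./2
    = \sum_(k < m.+1 | odd k) D k * (y ^+ 2) ^+ k./2.
  by apply: eq_bigr => k ->.
by rewrite s1 s2 s3 s4 !rmorphM !rmorph0 /=; ring.
Qed.

End KharitonovRectangle.

(** * Determinants under changes of two entries *)

Lemma det_mulmx_block (S : comNzRingType) (n q : nat) (X : 'M[S]_(n, q))
    (W : 'M[S]_(q, n)) : \det (X *m W) = \det (block_mx 1%:M (- W) X 0).
Proof.
have -> : block_mx 1%:M (- W) X 0 =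
    block_mx 1%:M 0 X 1%:M *m block_mx 1%:M (- W) 0 (X *m W).
  by rewrite mulmx_block !mul1mx !mul0mx mulmx1 !addr0 mulmxN addNr.
by rewrite det_mulmx det_lblock det_ublock !det1 !mul1r.
Qed.

(** Laplace expansion along row [i], whose cofactors do not involve that row. *)
Lemma det_row_perturbation (S : comNzRingType) (n : nat) (M : 'M[S]_n)
    (i j1 j2 : 'I_n) (s t : S) :
  \det (M + s *: delta_mx i j1 + t *: delta_mx i j2) =
  \det M + s * cofactor M i j1 + t * cofactor M i j2.
Proof.
rewrite (expand_det_row _ i) (expand_det_row M i).
have cofE j : cofactor (M + s *: delta_mx i j1 + t *: delta_mx i j2) i j =
    cofactor M i j.
  congr (_ * \det _); apply/matrixP => k l; rewrite !mxE.
  by rewrite eq_sym (negbTE (neq_lift _ _)) !mulr0 !addr0.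
have delta_sum (c : S) l : \sum_j c * (j == l)%:R * cofactor M i j =
    c * cofactor M i l.
  rewrite (bigD1 l) //= eqxx mulr1 big1 ?addr0 // => j /negbTE ->.
  by rewrite mulr0 mul0r.
rewrite -!delta_sum -!big_split; apply: eq_bigr => j _.
by rewrite cofE !mxE eqxx /= !mulrDl.
Qed.

(** In the block matrix the entries of [X] stand in the same row or column as before; the row
    expansion applies, after transposition for a common column. *)
Lemma det_mulmx_perturbation (S : comNzRingType) (n q : nat) (X : 'M[S]_(n, q))
    (W : 'M[S]_(q, n)) (i1 i2 : 'I_n) (j1 j2 : 'I_q) :
  i1 = i2 \/ j1 = j2 -> exists c1 c2, forall s t,
  \det ((X + s *: delta_mx i1 j1 + t *: delta_mx i2 j2) *m W) =
  \det (X *m W) + s * c1 + t * c2.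
Proof.
move=> ij; pose M := block_mx 1%:M (- W) X 0.
have blockE s t : block_mx 1%:M (- W)
    (X + s *: delta_mx i1 j1 + t *: delta_mx i2 j2) 0 =
    M + s *: delta_mx (rshift q i1) (lshift n j1) +
        t *: delta_mx (rshift q i2) (lshift n j2).
  have deltaE i j : delta_mx (rshift q i) (lshift n j) =
      block_mx 0 0 (delta_mx i j) 0 :> 'M[S]_(q + n).
    by rewrite delta_mx_dshift delta_mx_lshift -row_mx0.
  by rewrite !deltaE !scale_block_mx !add_block_mx !scaler0 !addr0.
move: blockE; case: ij => -> blockE.
  exists (cofactor M (rshift q i2) (lshift n j1)).
  exists (cofactor M (rshift q i2) (lshift n j2)) => s t.
  by rewrite !det_mulmx_block blockE det_row_perturbation.
exists (cofactor M^T (lshift n j2) (rshift q i1)).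
exists (cofactor M^T (lshift n j2) (rshift q i2)) => s t.
rewrite !det_mulmx_block blockE -det_tr !linearD !linearZ /= !trmx_delta.
by rewrite det_row_perturbation det_tr.
Qed.

(** Evaluation at a point is a ring morphism, so it commutes with products and determinants. *)
Lemma ceval_det_eq (R : realType) (n q : nat) (X Y : 'M[{poly R}]_(n, q))
    (W : 'M[{poly R}]_(q, n)) (x y : R) :
  (forall i j, ceval (X i j) x y = ceval (Y i j) x y) ->
  ceval (\det (X *m W)) x y = ceval (\det (Y *m W)) x y.
Proof.
move=> XY; pose h : {rmorphism {poly R} -> R[i]} :=
  horner_eval (Complex x y) \o map_poly (real_complex R).
rewrite -[LHS]/(h _) -[RHS]/(h _) -!det_map_mx !map_mxM.
by congr (\det (_ *m _)); apply/matrixP => i j; rewrite !mxE; exact: XY.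
Qed.

(** * Unstable matrices of Kharitonov points with few interior parameters *)

Section IntervalRectangularMatrix.
Variables (R : realType) (n q m d : nat) (L U : 'I_n -> 'I_q -> 'I_m.+1 -> R).
Variable W : 'M[{poly R}]_(q, n).
Hypothesis leLU : forall i j k, L i j k <= U i j k.

Definition interval_rect : set 'M[{poly R}]_(n, q) :=
  [set X | forall i j, interval_poly (L i j) (U i j) (X i j)].

Hypothesis size_det : forall X, interval_rect X -> size (\det (X *m W)) = d.+1.

(* The index [(i, j, c)] stands for the even ([c = false]) or odd ([c = true])
   part of the entry [(i, j)]. *)
Implicit Types (k : 'I_n * 'I_q * bool) (t : 'I_n * 'I_q * bool -> R).

Definition kharitonov_mx t : 'M[{poly R}]_(n, q) :=
  \matrix_(i, j) kharitonov_point (L i j) (U i j) (t (i, j, false)) (t (i, j, true)).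

Definition direction k : {poly R} :=
  let L' := L k.1.1 k.1.2 in let U' := U k.1.1 k.1.2 in
  (if k.2 then kharitonov2 L' U' else kharitonov3 L' U') - kharitonov1 L' U'.

Definition aligned k k' := (k.1.1 == k'.1.1) || (k.1.2 == k'.1.2).

Definition update2 t k k' a b k'' : R :=
  if k'' == k then a else if k'' == k' then b else t k''.

Lemma kharitonov_mx_interval t : (forall k, 0 <= t k <= 1) ->
  interval_rect (kharitonov_mx t).
Proof. by move=> t01 i j; rewrite mxE; apply: kharitonov_point_interval. Qed.

Lemma kharitonov_mx_update2 t k k' a b : k != k' ->
  kharitonov_mx (update2 t k k' a b) = kharitonov_mx (update2 t k k' 0 0) +
    (a *: direction k) *: delta_mx k.1.1 k.1.2 +
    (b *: direction k') *: delta_mx k'.1.1 k'.1.2.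
Proof.
move: k k' => [[i1 j1] c1] [[i2 j2] c2] kk'; apply/matrixP => i j.
rewrite !mxE /kharitonov_point /update2 /direction /= !xpair_eqE in kk' *.
have [e1|ne1] := boolP ((i == i1) && (j == j1)); last first.
  have [/andP[/eqP <- /eqP <-]|ne2] := boolP ((i == i2) && (j == j2)).
    by case: c2 {kk'} => /=; rewrite -!mul_polyC rmorph0; ring.
  by rewrite !mulr0 !addr0.
case/andP: e1 kk' => /eqP <- /eqP <-.
have [/andP[/eqP <- /eqP <-]|ne2] := boolP ((i == i2) && (j == j2)).
  rewrite ?eqxx /=.
  by case: c1; case: c2 => //= _; rewrite -!mul_polyC rmorph0; ring.
by case: c1 => /= _; rewrite -!mul_polyC rmorph0; ring.
Qed.

(** Induction on the number of interior parameters: while two aligned ones remain, the edge theorem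
    sends one of them to an end. *)
Lemma kharitonov_mx_sparse t : (forall k, 0 <= t k <= 1) ->
  ~ stable_poly (\det (kharitonov_mx t *m W)) ->
  exists t', [/\ forall k, 0 <= t' k <= 1,
    ~ stable_poly (\det (kharitonov_mx t' *m W)) &
    forall k k', aligned k k' -> 0 < t' k < 1 -> 0 < t' k' < 1 -> k = k'].
Proof.
have [c] := ubnP #|[pred k | 0 < t k < 1]|.
elim: c t => // c IH t tc t01 unst.
have [|] := boolP [forall k, [forall k', [==> aligned k k', 0 < t k < 1,
    0 < t k' < 1 => k == k']]].
  move=> /forallP sparse; exists t; split=> // k k' al tk tk'; apply/eqP.
  by have /forallP/(_ k') := sparse k; rewrite al tk tk'.
rewrite negb_forall => /existsP[k]; rewrite negb_forall => /existsP[k'].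
rewrite !negb_imply => /and4P[al tk tk' kk'].
have al' : k.1.1 = k'.1.1 \/ k.1.2 = k'.1.2.
  by case/orP: al => /eqP; [left|right].
have [c1 [c2 detE]] := det_mulmx_perturbation (kharitonov_mx (update2 t k k' 0 0))
  W al'.
set f0 := \det (_ *m W) in detE.
have updE a b : \det (kharitonov_mx (update2 t k k' a b) *m W) =
    f0 + a *: (direction k * c1) + b *: (direction k' * c2).
  by rewrite kharitonov_mx_update2 // detE !scalerAl.
have upd01 a b : 0 <= a <= 1 -> 0 <= b <= 1 ->
    forall k'', 0 <= update2 t k k' a b k'' <= 1.
  by move=> a01 b01 k''; rewrite /update2; case: ifP => // _; case: ifP.
have tE : \det (kharitonov_mx t *m W) =
    f0 + t k *: (direction k * c1) + t k' *: (direction k' * c2).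
  rewrite -updE; congr (\det (kharitonov_mx _ *m W)); apply/funext => k''.
  by rewrite /update2; case: eqP => [->//|_]; case: eqP => [->|].
rewrite tE in unst.
have size_upd a b : 0 <= a <= 1 -> 0 <= b <= 1 ->
    size (f0 + a *: (direction k * c1) + b *: (direction k' * c2)) = d.+1.
  move=> a01 b01; rewrite -updE; apply: size_det.
  exact/kharitonov_mx_interval/upd01.
have [a [b [a01 b01 bd]]] :=
  square_boundary_unstable size_upd (t01 k) (t01 k') unst.
rewrite -updE => unst'; apply: IH unst'; last exact: upd01.
rewrite -ltnS; apply: leq_trans tc; rewrite ltnS; apply: proper_card.
have k'k : (k' == k) = false by rewrite eq_sym (negbTE kk').
(* Only [k] and [k'] change, and both were interior; the one sent to an end leaves the set. *)
apply/properP; split.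
  apply/fintype.subsetP => k''; rewrite !inE /update2.
  by case: eqP => [->//|_]; case: eqP => [->//|].
case: bd => E; [exists k|exists k|exists k'|exists k'] => //;
  by rewrite !inE /update2 ?eqxx ?k'k E ?ltxx ?andbF.
Qed.

(* The crossing of the imaginary axis is found by changing one row at a time, along
   which the determinant is affine. *)
Lemma kharitonov_mx_unstable X : interval_rect X ->
  ~ stable_poly (\det (X *m W)) ->
  exists2 t, forall k, 0 <= t k <= 1 &
    ~ stable_poly (\det (kharitonov_mx t *m W)).
Proof.
move=> IX unst; pose Y := kharitonov_mx (fun=> 0).
have IY : interval_rect Y.
  by apply: kharitonov_mx_interval => k; rewrite lexx ler01.
have [stY|] := pselect (stable_poly (\det (Y *m W))); last first.
  by exists (fun=> 0) => // k; rewrite lexx ler01.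
(* The first [h] rows come from [X], the others from the stable corner [Y]; stability is lost at
   some row [i]. *)
pose H (h : nat) : 'M[{poly R}]_(n, q) :=
  \matrix_(i, j) if (i < h)%N then X i j else Y i j.
have HY : H 0%N = Y by apply/matrixP => i j; rewrite mxE ltn0.
have HX : H n = X by apply/matrixP => i j; rewrite mxE ltn_ord.
have [i [sti unsti]] : exists i : 'I_n,
    stable_poly (\det (H i *m W)) /\ ~ stable_poly (\det (H i.+1 *m W)).
  apply: contrapT => no; apply: unst; rewrite -HX.
  have st h : (h <= n)%N -> stable_poly (\det (H h *m W)).
    elim: h => [_|h IH hn]; first by rewrite HY.
    apply: contrapT => unsth; apply: no; exists (Ordinal hn); split=> //=.
    exact: IH (ltnW hn).
  exact: st.
have IH h : interval_rect (H h) by move=> i' j'; rewrite mxE; case: ifP.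
pose Z (a : R) := (1 - a)%:P *: H i + a%:P *: H i.+1.
have ZmxE a i' j' : Z a i' j' = (1 - a)%:P * H i i' j' + a%:P * H i.+1 i' j'.
  by rewrite mxE [X in X + _]mxE [X in _ + X]mxE.
have IZ a : 0 <= a <= 1 -> interval_rect (Z a).
  move=> a01 i' j'; rewrite ZmxE.
  have conv p r : interval_poly (L i' j') (U i' j') p ->
      interval_poly (L i' j') (U i' j') r ->
      interval_poly (L i' j') (U i' j') ((1 - a)%:P * p + a%:P * r).
    move=> [u uLU ->] [v vLU ->].
    exists (fun l => (1 - a) * u l + a * v l).
      by move=> l; have := uLU l; have := vLU l; nra.
    by rewrite !mul_polyC !poly_of_coefsZ poly_of_coefsD.
  by apply: conv; exact: IH.
have HE i' j' : i' != i -> H i.+1 i' j' = H i i' j'.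
  by move=> i'i; rewrite !mxE ltnS leq_eqVlt (inj_eq val_inj) (negbTE i'i).
have rowE a (V : 'M[{poly R}]_(n, q)) :
    (forall i' j', i' != i -> V i' j' = H i i' j') ->
    row' i (V *m W) = row' i (Z a *m W).
  move=> VH; apply/matrixP => i' j'; rewrite !mxE; apply: eq_bigr => l _.
  congr (_ * _).
  have ne : lift i i' != i by rewrite eq_sym neq_lift.
  by rewrite ZmxE VH // HE // -mulrDl -rmorphD subrK mul1r.
(* [H i] and [H i.+1] agree outside row [i], so the determinant is affine along the segment [Z]. *)
have ZE a : \det (Z a *m W) = \det (H i *m W) +
    a *: (\det (H i.+1 *m W) - \det (H i *m W)).
  rewrite (@determinant_multilinear _ _ _ (H i *m W) (H i.+1 *m W) i
    (1 - a)%:P a%:P).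
  - by rewrite !mul_polyC scalerBl scalerBr scale1r addrAC addrA.
  - by rewrite /Z mulmxDl -!scalemxAl linearD !linearZ.
  - exact: rowE.
  - by apply: rowE => *; exact: HE.
have size_Z a : 0 <= a <= 1 -> size (\det (H i *m W) +
    a *: (\det (H i.+1 *m W) - \det (H i *m W))) = d.+1.
  by move=> a01; rewrite -ZE; apply: size_det; exact: IZ.
rewrite -(subrK (\det (H i *m W)) (\det (H i.+1 *m W))) addrC in unsti.
have [a [y [a01 z0]]] := imaginary_crossing size_Z sti unsti.
rewrite -ZE in z0.
(* Each entry of the singular matrix is replaced by a Kharitonov point with the same value at
   [i y]. *)
have /choice[t tP] : forall e : 'I_n * 'I_q, exists lu : R * R,
    [/\ 0 <= lu.1 <= 1, 0 <= lu.2 <= 1 &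
     ceval (Z a e.1 e.2) 0 y =
     ceval (kharitonov_point (L e.1 e.2) (U e.1 e.2) lu.1 lu.2) 0 y].
  move=> [i' j']; have [l [u luP]] := kharitonov_rectangle y (IZ a a01 i' j').
  by exists (l, u).
exists (fun k => if k.2 then (t k.1).2 else (t k.1).1).
  by move=> [e c] /=; case: (tP e); case: c.
apply/not_stableP; exists 0, y; split=> //; rewrite -[RHS]z0.
apply: ceval_det_eq => i' j'; rewrite [kharitonov_mx _ _ _]mxE /=.
by case: (tP (i', j')).
Qed.

Lemma kharitonov_mx_vertex t i j : (forall k, 0 <= t k <= 1) ->
  (forall c, ~~ (0 < t (i, j, c) < 1)) ->
  vertex_set (L i j) (U i j) (kharitonov_mx t i j).
Proof.
move=> t01 tint; rewrite mxE.
by apply: kharitonov_point_vertex; apply: unit_not_interior.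
Qed.

(** The two parts of one entry are aligned, so at most one is interior and the other fixes a side of
    the rectangle. *)
Lemma kharitonov_mx_edge t i j : (forall k, 0 <= t k <= 1) ->
  (forall k k', aligned k k' -> 0 < t k < 1 -> 0 < t k' < 1 -> k = k') ->
  edge_set (L i j) (U i j) (kharitonov_mx t i j).
Proof.
move=> t01 sparse; rewrite mxE; apply: kharitonov_point_edge => //.
have [tf|/unit_not_interior[]//] := boolP (0 < t (i, j, false) < 1);
  [|by constructor 1|by constructor 2].
have [tt|/unit_not_interior[]//] := boolP (0 < t (i, j, true) < 1);
  [|by constructor 3|by constructor 4].
by have := sparse _ _ _ tf tt; rewrite /aligned eqxx => /(_ isT).
Qed.

End IntervalRectangularMatrix.

(** * The degree of the determinant *)

Lemma coefM_top (S : comNzRingType) (p r : {poly S}) (a b : nat) :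
  (size p <= a.+1)%N -> (size r <= b.+1)%N -> (p * r)`_(a + b) = p`_a * r`_b.
Proof.
move=> sp sr; rewrite coefM (bigD1 (inord a)) //= inordK ?ltnS ?leq_addr //.
rewrite addKn big1 ?addr0 // => j ja.
have {}ja : (j != a :> nat)%N.
  apply: contra ja => /eqP ja; apply/eqP/val_inj.
  by rewrite /= inordK ?ltnS ?leq_addr.
(* For [j < a] the index in [r] exceeds [b]; for [j > a] the coefficient of [p] vanishes. *)
case: (ltngtP j a) ja => // ja _.
  rewrite [r`__]nth_default ?mulr0 // (leq_trans sr) // -(ltn_add2l j) subnKC.
    by rewrite ltn_add2r.
  by rewrite -ltnS.
by rewrite nth_default ?mul0r // (leq_trans sp).
Qed.

Lemma prod_top (S : comNzRingType) (I : Type) (N : nat) (rs : seq I)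
    (p : I -> {poly S}) : (forall i, (size (p i) <= N.+1)%N) ->
  (size (\prod_(i <- rs) p i)%R <= (size rs * N).+1)%N /\
  (\prod_(i <- rs) p i)`_(size rs * N) = \prod_(i <- rs) (p i)`_N.
Proof.
move=> sp; elim: rs => [|i rs [IHs IHc]].
  by rewrite !big_nil size_poly1 coef1.
rewrite !big_cons mulSn coefM_top // IHc; split=> //.
apply: leq_trans (size_polyMleq _ _) _.
by rewrite -subn1 leq_subLR add1n -addnS -addSn leq_add.
Qed.

(** The coefficient of degree [n * N] in the Leibniz formula is the determinant of the leading
    matrix. This makes the degree constant on the family. *)
Lemma size_det_leading (S : comNzRingType) (n N : nat) (M : 'I_N.+1 -> 'M[S]_n) :
  \det (M ord_max) != 0 ->
  size (\det (\sum_(k < N.+1) 'X^k *: map_mx polyC (M k))) = (n * N).+1.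
Proof.
set P := \sum_(k < _) _ => M0.
have PE i j : P i j = \poly_(k < N.+1) M (inord k) i j.
  rewrite summxE poly_def; apply: eq_bigr => k _.
  by rewrite !mxE inord_val mulrC mul_polyC.
have Ps i j : (size (P i j) <= N.+1)%N by rewrite PE size_poly.
have PN i j : (P i j)`_N = M ord_max i j.
  by rewrite PE coef_poly ltnSn -[N in inord N]/(val (@ord_max N)) inord_val.
have top (s : 'S_n) : (size (\prod_i P i (s i))%R <= (n * N).+1)%N /\
    (\prod_i P i (s i))`_(n * N) = \prod_i M ord_max i (s i).
  have [] := prod_top (enum 'I_n) (fun i => Ps i (s i)).
  rewrite !big_enum /= size_enum_ord => sz ->; split=> //.
  exact: eq_bigr.
have signE (s : 'S_n) k : ((-1) ^+ s * \prod_i P i (s i))`_k =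
    (-1) ^+ s * (\prod_i P i (s i))`_k.
  by rewrite -[(-1) ^+ s in LHS](rmorph_sign polyC) coefCM.
apply/eqP; rewrite eqn_leq; apply/andP; split.
  apply/leq_sizeP => k nNk; rewrite coef_sum big1 // => s _.
  by rewrite signE nth_default ?mulr0 // (leq_trans (top s).1).
rewrite ltnNge; apply: contra M0 => sz; apply/eqP.
rewrite -[LHS](_ : (\det P)`_(n * N) = _); first by rewrite nth_default.
by rewrite coef_sum; apply: eq_bigr => s _; rewrite signE (top s).2.
Qed.

(** * Extending partial injections to permutations *)

Lemma perm_extension (T : finType) (f : T -> T) (A : {set T}) :
  {in A &, injective f} -> exists s : {perm T}, {in A, s =1 f}.
Proof.
have [c] := ubnP #|A|; elim: c A => // c IH A Ac fA.
have [->|[x xA]] := set_0Vmem A; first by exists 1%g => y; rewrite inE.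
have [||s sE] := IH (A :\ x)%SET.
- by move: Ac; rewrite (cardsD1 x) xA.
- by move=> y z /setD1P[_ yA] /setD1P[_ zA]; apply: fA.
(* The transposition corrects the value at [x] and, by injectivity of [f], leaves the other values
   on [A] alone. *)
exists (s * tperm (s x) (f x))%g => y yA; rewrite permM.
have [->|yx] := eqVneq y x; first by rewrite tpermL.
rewrite tpermD.
- by apply: sE; rewrite !inE yx.
- by rewrite (inj_eq perm_inj) eq_sym.
rewrite sE ?inE ?yx //; apply: contra yx => /eqP fxy.
by apply/eqP; apply: fA.
Qed.

(** [S] is the graph of a partial injection; the default value of [f] is taken only outside its
    domain. *)
Lemma partial_injection_perm (T : finType) (S : rel T) :
  (forall i j j', S i j -> S i j' -> j = j') ->
  (forall i i' j, S i j -> S i' j -> i = i') ->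
  exists s : {perm T}, forall i j, S i j -> j = s i.
Proof.
move=> rowS colS; pose f i := odflt i [pick j | S i j].
have fS i j : S i j -> f i = j.
  move=> Sij; rewrite /f; case: pickP => [j' Sij'|/(_ j)]; last by rewrite Sij.
  exact: rowS Sij' Sij.
have [|s sE] := @perm_extension _ f [set i | [exists j, S i j]]%SET.
  move=> i i'; rewrite !inE => /existsP[j Sij] /existsP[j' Sij'].
  by rewrite (fS _ _ Sij) (fS _ _ Sij') => jj'; apply: colS Sij _; rewrite jj'.
exists s => i j Sij; rewrite sE ?(fS _ _ Sij) // inE.
by apply/existsP; exists j.
Qed.

(** * From a sparse unstable matrix to a testing pair *)

Theorem theorem1 (R : realType) (n m : nat) (n_gt0 : (0 < n)%N)
    (A C : 'M[{poly R}]_n)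
    (BL BU DL DU : 'I_n -> 'I_n -> 'I_m.+1 -> R)
    (leB : forall i j k, BL i j k <= BU i j k)
    (leD : forall i j k, DL i j k <= DU i j k)
    (lead : nonsingular_leading (mx_family A C BL BU DL DU)) :
  (forall B D : 'M[{poly R}]_n,
      interval_mx BL BU B -> interval_mx DL DU D ->
      stable_mx (B *m A + D *m C))
  <->
  (forall B D : 'M[{poly R}]_n,
      testing_set BL BU DL DU (B, D) ->
      stable_mx (B *m A + D *m C)).
Proof.
split=> [st B D [[/= [IB _] [ID _]] _]|st B D IB ID]; first exact: st.
apply: contrapT => unst.
(* Bounds for the entries of [row_mx B D]. *)
pose join (b d : 'I_n -> 'I_n -> 'I_m.+1 -> R) (i : 'I_n)
    (j : 'I_(n + n)) : 'I_m.+1 -> R :=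
  match fintype.split j with inl j => b i j | inr j => d i j end.
have joinl b d i j : join b d i (lshift n j) = b i j.
  by rewrite /join (unsplitK (inl j)).
have joinr b d i j : join b d i (rshift n j) = d i j.
  by rewrite /join (unsplitK (inr j)).
have leLU i j k : join BL DL i j k <= join BU DU i j k.
  by rewrite /join; case: fintype.split.
have IE X : interval_rect (join BL DL) (join BU DU) X ->
    interval_mx BL BU (lsubmx X) /\ interval_mx DL DU (rsubmx X).
  move=> IX; split=> i j; rewrite mxE.
    by have := IX i (lshift n j); rewrite !joinl.
  by have := IX i (rshift n j); rewrite !joinr.
have mulE X : X *m col_mx A C = lsubmx X *m A + rsubmx X *m C.
  by rewrite -[X in X *m _]hsubmxK mul_row_col.
have [N leadN] := lead.
have size_det X : interval_rect (join BL DL) (join BU DU) X ->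
    size (\det (X *m col_mx A C)) = (n * N).+1.
  move=> /IE[IXB IXD]; have [|M -> M0] := leadN (X *m col_mx A C).
    by exists (lsubmx X), (rsubmx X); rewrite mulE.
  exact: size_det_leading.
have IBD : interval_rect (join BL DL) (join BU DU) (row_mx B D).
  move=> i j; rewrite -[j]splitK; case: (fintype.split j) => l /=.
    by rewrite row_mxEl !joinl.
  by rewrite row_mxEr !joinr.
have unstBD : ~ stable_poly (\det (row_mx B D *m col_mx A C)).
  by rewrite mul_row_col.
have [t t01 unst_t] := kharitonov_mx_unstable leLU size_det IBD unstBD.
have [t' [t'01 unst_t' sparse]] := kharitonov_mx_sparse leLU size_det t01 unst_t.
set X := kharitonov_mx _ _ t' in unst_t'.
have IX : interval_rect (join BL DL) (join BU DU) X.
  exact: kharitonov_mx_interval.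
have [IXB IXD] := IE _ IX.
(* These are the entries that may fail to be vertices; there is at most one per row and per column
   of the joined matrix. *)
pose inner i j := [exists c, 0 < t' (i, j, c) < 1].
have inner_row i j j' : inner i j -> inner i j' -> j = j'.
  move=> /existsP[c tc] /existsP[c' tc'].
  by have := sparse _ _ _ tc tc'; rewrite /aligned eqxx => /(_ isT)[].
have inner_col i i' j : inner i j -> inner i' j -> i = i'.
  move=> /existsP[c tc] /existsP[c' tc'].
  by have := sparse _ _ _ tc tc'; rewrite /aligned eqxx orbT => /(_ isT)[].
have edgeX i j : edge_set (join BL DL i j) (join BU DU i j) (X i j).
  exact: kharitonov_mx_edge.
have vertexX i j : ~~ inner i j ->
    vertex_set (join BL DL i j) (join BU DU i j) (X i j).
  move=> ni; apply: kharitonov_mx_vertex => // c.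
  by apply: contra ni => tc; apply/existsP; exists c.
have BE i j : edge_set (BL i j) (BU i j) (lsubmx X i j).
  by have := edgeX i (lshift n j); rewrite !joinl [lsubmx _ _ _]mxE.
have DE i j : edge_set (DL i j) (DU i j) (rsubmx X i j).
  by have := edgeX i (rshift n j); rewrite !joinr [rsubmx _ _ _]mxE.
have BV i j : ~~ inner i (lshift n j) ->
    vertex_set (BL i j) (BU i j) (lsubmx X i j).
  by move/vertexX; rewrite !joinl [lsubmx _ _ _]mxE.
have DV i j : ~~ inner i (rshift n j) ->
    vertex_set (DL i j) (DU i j) (rsubmx X i j).
  by move/vertexX; rewrite !joinr [rsubmx _ _ _]mxE.
apply: unst_t'; rewrite mulE; apply: st; split.
  split; split=> //=.
    have [||s sE] := @partial_injection_perm _ (fun i j => inner i (lshift n j)).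
    - by move=> i j j' ij ij'; apply: (@lshift_inj n n); apply: inner_row ij ij'.
    - by move=> i i' j; apply: inner_col.
    exists s => i j; split=> [_|ne]; first exact: BE.
    apply: BV; apply/negP => /sE.
    exact: ne.
  have [||s sE] := @partial_injection_perm _ (fun i j => inner i (rshift n j)).
  - by move=> i j j' ij ij'; apply: (@rshift_inj n n); apply: inner_row ij ij'.
  - by move=> i i' j; apply: inner_col.
  exists s => i j; split=> [_|ne]; first exact: DE.
  apply: DV; apply/negP => /sE.
  exact: ne.
(* [eta] points to the inner entry of row [i], in either block. In a row without one the default [i]
   is harmless, since every entry lies in its edge set. *)
exists (fun i => odflt i [pick j | inner i (lshift n j) || inner i (rshift n j)]).
(* The blocks occupy different columns, so a row cannot have an inner entry in both; hence the
   partner of an inner entry is a vertex. *)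
move=> i j; have lr j' j'' : inner i (lshift n j') -> ~~ inner i (rshift n j'').
  move=> ij'; apply/negP => ij''; have /eqP := inner_row _ _ _ ij' ij''.
  by rewrite eq_lrshift.
case: pickP => [j' ij'|no] /=; last first.
  have /norP[nl nr] : ~~ (inner i (lshift n j) || inner i (rshift n j)) by rewrite no.
  by split=> _; [left; split; [exact: BE|exact: DV]|split; [exact: BV|exact: DV]].
split=> [->|ne].
  have [il|nl] := boolP (inner i (lshift n j')).
    by left; split; [exact: BE|apply: DV; exact: lr il].
  by right; split; [exact: BV|exact: DE].
have {}ne : ~~ inner i (lshift n j) /\ ~~ inner i (rshift n j).
  case/orP: ij' => ij'; split.
  - by apply/negP => ij; apply: ne; apply: (@lshift_inj n n); apply: inner_row ij ij'.
  - exact: lr ij'.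
  - by apply/negP => ij; have := lr _ j' ij; rewrite ij'.
  - by apply/negP => ij; apply: ne; apply: (@rshift_inj n n); apply: inner_row ij ij'.
by case: ne => nl nr; split; [exact: BV|exact: DV].
Qed.
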